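(* Let $A=(a_{ij})$ be an $n\times n$ complex matrix and let $A(t)=A_0+t(A-A_0)$, where $t\in[0,1]$ and $A_0=\mathrm{diag}(a_{11},\dots,a_{nn})$. Then a connected Geršgorin region of $A$ contains the same number of eigenvalues of $A(t)$, counted with algebraic multiplicities, for all $t\in[0,1]$.
   Context: For an $n\times n$ complex matrix $A=(a_{ij})$, the Geršgorin disks of $A$ are the closed disks $D_i=\{z\in\mathbb{C}: |z-a_{ii}|\le \sum_{j\neq i}|a_{ij}|\}$, $i=1,\dots,n$. A Geršgorin region is a union of some Geršgorin disks (which in general need not be connected); in particular, the singletons of diagonal entries are degenerate Geršgorin regions. A connected Geršgorin region is a Geršgorin region that is connected.
   Formalization: ''Connected Geršgorin region'' is taken as a nonempty maximal one (a connected component of the union of all disks); for an arbitrary connected union of disks the claim fails, e.g. A = [[1,-1],[2,-1]] with the disk |z-1| ≤ 1. *)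

(* Defs.v *)
From HB Require Import structures.
From mathcomp Require Import all_boot all_order all_algebra.
From mathcomp Require Import complex.
From mathcomp Require Import all_classical all_reals all_analysis.

Set Implicit Arguments.
Unset Strict Implicit.
Unset Printing Implicit Defensive.

Import Order.TTheory GRing.Theory Num.Theory.
Import numFieldNormedType.Exports.

Local Open Scope classical_set_scope.
Local Open Scope ring_scope.
Local Open Scope complex_scope.

(* Not [closed_ball], which is the closure of the open ball and hence empty
   for a vanishing radius. *)
Definition gersgorin_disk (R : realType) (n : nat) (A : 'M[R[i]]_n)
    (i : 'I_n) : set R[i] :=
  [set z | `|z - A i i| <= \sum_(j < n | j != i) `|A i j|].

Definition gersgorin_region (R : realType) (n : nat) (A : 'M[R[i]]_n)
    (G : set R[i]) : Prop :=
  exists2 S : {set 'I_n}, S != finset.set0 &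
    G = \bigcup_(i in [set` S]) gersgorin_disk A i.

(* "Connected region" is meant in the sense of a connected component of the
   union of all the disks, i.e. a maximal connected region.  Without maximality
   eigenvalues may leave the region: for A = [[1, -1], [2, -1]], the disk of
   center 1 and radius 1 is connected and contains the eigenvalue 1 of A(0),
   but neither of the eigenvalues i, -i of A.
   The topology of the modulus is found on the alias R[i]^o of R[i]. *)
Definition connected_gersgorin_region (R : realType) (n : nat)
    (A : 'M[R[i]]_n) (G : set R[i]) : Prop :=
  [/\ gersgorin_region A G,
      connected (G : set R[i]^o) &
      forall H : set R[i], gersgorin_region A H -> connected (H : set R[i]^o) ->
        G `<=` H -> H = G].

Definition diag_part (R : realType) (n : nat) (A : 'M[R[i]]_n) : 'M[R[i]]_n :=
  diag_mx (\row_i A i i).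

Definition gersgorin_path (R : realType) (n : nat) (A : 'M[R[i]]_n) (t : R) :
    'M[R[i]]_n :=
  diag_part A + t%:C *: (A - diag_part A).

(* The set of eigenvalues of B is finite, so the big operator, which is trivial
   over infinite supports, does add up all the multiplicities. *)
Definition count_eigenvalues (R : realType) (n : nat) (B : 'M[R[i]]_n)
    (G : set R[i]) : nat :=
  \big[addn/0%N]_(z \in G `&` [set z | eigenvalue B z]) mup z (char_poly B).

(* Main.v *)
Require Import Defs.
From mathcomp Require Import all_boot all_order all_algebra.
From mathcomp Require Import perm complex.
From mathcomp Require Import all_classical all_reals all_analysis.

(** The eigenvalues of A(t) move continuously and stay in the disks of A, and G
is separated from the disks outside it, so none can enter or leave G.

Separation.  A disk that meets G enlarges it to a connected region, so by
maximality it lies in G ([gersgorin_disk_dichotomy]).  Hence G and the union L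
of the disks that miss G are disjoint compact sets.  The off-diagonal row sums
of A(t) are t times those of A, with the same diagonal, so Gersgorin's theorem
puts the whole spectrum of A(t) in the union of G and L for t in [0, 1]
([eigenvalue_gersgorin_path]).

Constancy of the count ([count_eigenvalues_homotopy]).  Instead of choosing
continuous branches of eigenvalues, list the eigenvalues of A(t) as
lam_0, ..., lam_(n-1) with multiplicity, and for a set J of indices consider
the parameters t for which some listing has lam_i in G for i in J and in L
otherwise.  The pairs (t, lam) with this property form a compact set: a product
of compact sets (Tychonoff) cut out by the closed condition
det (z - A(t)) = prod_i (z - lam_i) for all z.  Its projection to t is
therefore closed.  On this projection the count is the cardinal of J, so every
level set of the count, and also its complement in [0, 1], is a finite union of
closed sets; connectedness of [0, 1] concludes. *)

Set Implicit Arguments.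
Unset Strict Implicit.
Unset Printing Implicit Defensive.

Import Order.TTheory GRing.Theory Num.Theory.
Import numFieldNormedType.Exports.

Local Open Scope classical_set_scope.
Local Open Scope ring_scope.
Local Open Scope complex_scope.

(** * Continuity of polynomial expressions *)

Section Continuity.
Context {K : numFieldType} {T : topologicalType}.

Lemma continuous_big (U : topologicalType) (idx : U) (op : U -> U -> U)
    (I : Type) (r : seq I) (P : pred I) (F : I -> T -> U) :
  continuous (fun p : U * U => op p.1 p.2) ->
  (forall i, P i -> continuous (F i)) ->
  continuous (fun t => \big[op/idx]_(i <- r | P i) F i t).
Proof.
move=> cop cF; elim: r => [|i r IH].
  rewrite [X in continuous X](_ : _ = cst idx); first exact: cst_continuous.
  by apply/funext => u; rewrite big_nil.
have [Pi|nPi] := boolP (P i); last first.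
  rewrite [X in continuous X](_ : _ =
    fun t => \big[op/idx]_(j <- r | P j) F j t)//.
  by apply/funext => t; rewrite big_cons (negbTE nPi).
rewrite [X in continuous X](_ : _ = (fun p => op p.1 p.2) \o
    fun t => (F i t, \big[op/idx]_(j <- r | P j) F j t)).
  move=> t; apply: continuous_comp; last exact: cop.
  by apply: cvg_pair; [exact: cF|exact: IH].
by apply/funext => t; rewrite big_cons Pi.
Qed.

Lemma continuous_det n (M : T -> 'M[K]_n) :
  (forall i j, continuous (fun t => M t i j : K^o)) ->
  continuous (fun t => \det (M t) : K^o).
Proof.
move=> cM; rewrite [X in continuous X](_ : _ = fun t : T => \sum_(s : 'S_n)
  (cst ((-1) ^+ s) \* (fun t => \prod_i M t i (s i))) t : K^o)//.
apply: continuous_big => [|s _ t]; first exact: add_continuous.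
apply: continuousM; first exact: cst_continuous.
apply: (@continuous_big _ _ _ _ _ _ (fun i t => M t i (s i))) => //.
exact: mul_continuous.
Qed.

End Continuity.

Lemma horner_char_poly (F : comNzRingType) n (B : 'M[F]_n) z :
  (char_poly B).[z] = \det (z%:M - B).
Proof.
rewrite -horner_evalE -det_map_mx; congr (\det _).
by apply/matrixP=> i j; rewrite !mxE /= !horner_evalE !hornerE hornerMn hornerX.
Qed.

(** An identity of polynomials can be tested pointwise in characteristic zero;
this turns equality of characteristic polynomials into a closed condition. *)
Lemma poly_ext (F : numDomainType) (p q : {poly F}) :
  (forall x, p.[x] = q.[x]) -> p = q.
Proof.
move=> pq; apply/eqP; rewrite -subr_eq0; apply/eqP.
apply: (@roots_geq_poly_eq0 _ _ [seq k%:R | k <- iota 0 (size (p - q))]).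
- by apply/allP => x _; rewrite rootE hornerD hornerN pq subrr.
- rewrite map_inj_uniq ?iota_uniq//; exact/mulrIn/oner_neq0.
- by rewrite size_map size_iota.
Qed.

(** * Disks of the complex plane *)

Section ComplexTopology.
Context {R : realType}.
Local Notation C := (R[i]^o).

Lemma continuous_real_complex : continuous ((fun x => x%:C) : R -> C).
Proof.
move=> x; apply/cvgrPdist_lt => e e0.
(* A positive complex number is real, which makes the radius e usable in R. *)
have eR : e = (complex.Re e)%:C by rewrite RRe_real ?gtr0_real.
have {}e0 : 0 < complex.Re e by move: e0; rewrite {1}eR ltcR.
near=> y; rewrite -rmorphB normc_def /= expr0n/= addr0 sqrtr_sqr eR ltcR.
near: y; exact: cvgr_dist_lt.
Unshelve. all: by end_near. Qed.

(** The box is the image of a compact square of R * R: compactness of bounded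
closed sets is transferred from the real plane this way. *)
Lemma compact_complex_box (M : R) :
  compact [set z : C | `|complex.Re z| <= M /\ `|complex.Im z| <= M].
Proof.
pose f : R * R -> C :=
  (fun p => p.1%:C) \+ (cst 'i : _ -> C) \* (fun p => p.2%:C).
rewrite (_ : mkset _ = f @` (`[- M, M] `*` `[- M, M])).
  apply: continuous_compact; last first.
    by apply: compact_setX; exact: segment_compact.
  apply: continuous_subspaceT => p; apply: continuousD.
    apply: continuous_comp; first exact: cvg_fst.
    exact: continuous_real_complex.
  apply: continuousM; first exact: cst_continuous.
  apply: continuous_comp; first exact: cvg_snd.
  exact: continuous_real_complex.
apply/seteqP; split=> [[x y]|_ [[x y] [/= + +] <-]]/=; rewrite !ler_norml.
  move=> [xM yM]; exists (x, y); first by rewrite !in_itv.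
  by rewrite [RHS]complexE.
by rewrite !in_itv /= !(mul0r, mul1r, subr0, addr0, add0r).
Qed.

(** Although the order of R[i] is partial, a modulus can be compared with a real
radius: outside the disk the strict reverse inequality holds, and that is an
open condition. *)
Lemma closed_disk (c r : C) :
  r \is Num.real -> closed [set z : C | `|z - c| <= r].
Proof.
move=> rR; rewrite -[X in closed X]setCK; apply: open_closedC.
rewrite openE => z /= /negP; rewrite -real_ltNge ?normr_real// => rz.
have : (fun w : C => w - c) @ z --> z - c.
  by apply: continuousB; [exact: id|exact: cst_continuous].
move=> /cvgr_norm_gt /(_ _ rz); apply: filterS => w rw.
by apply/negP; rewrite -real_ltNge ?normr_real.
Qed.

Lemma compact_disk (c r : C) :
  r \is Num.real -> compact [set z : C | `|z - c| <= r].
Proof.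
move=> rR; pose M := complex.Re (r + `|c|).
apply: (subclosed_compact (closed_disk rR) (@compact_complex_box M)).
move=> z /= zr.
have zM : `|z| <= M%:C.
  rewrite RRe_real ?rpredD ?normr_real//.
  by rewrite -[z](subrK c) (le_trans (ler_normD _ _))// lerD2r.
split; rewrite -lecR (le_trans _ zM) ?normc_ge_Re//.
(* Multiplication by the imaginary unit exchanges, up to sign, the real and
   imaginary parts. *)
have := normc_ge_Re (z * 'i); rewrite normrM ReiNIm normrN.
by rewrite (normc_def 'i) /= expr0n expr1n/= add0r sqrtr1 mulr1.
Qed.

(** A disk is star-shaped about its center: it is the union of the segments from
the center to its points, which are connected and share the center. *)
Lemma connected_disk (c r : C) :
  0 <= r -> connected [set z : C | `|z - c| <= r].
Proof.
move=> r0.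
pose seg (z : C) : set C := (fun t : R => c + t%:C * (z - c)) @` `[0, 1].
rewrite (_ : mkset _ = \bigcup_(z in [set z | `|z - c| <= r]) seg z).
  apply: bigcup_connected.
    exists c => z _; exists 0; first by rewrite /= in_itv /= lexx ler01.
    by rewrite rmorph0 mul0r addr0.
  move=> z _; apply: connected_continuous_connected.
    exact: segment_connected.
  apply: continuous_subspaceT => t.
  apply: (@continuousD _ _ _ (cst c) ((fun t => t%:C) \* cst (z - c))).
    exact: cst_continuous.
  apply: continuousM; first exact: continuous_real_complex.
  exact: cst_continuous.
apply/seteqP; split=> [z zr|_ [z /= zr] [t /= + <-]].
  exists z => //; exists 1; first by rewrite /= in_itv /= lexx ler01.
  by rewrite rmorph1 mul1r addrC subrK.
rewrite in_itv /= => /andP[t0 t1]; rewrite addrAC subrr add0r normrM.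
apply: le_trans zr; rewrite ler_piMl// ger0_norm ?ler0c//.
by rewrite -[1]/(1%:C) lecR.
Qed.

End ComplexTopology.

(** * Invariance of the number of eigenvalues along a path *)

(** The multiplicity of a root is its number of occurrences in any list that
splits the polynomial, so the count can be read off such a list. *)
Lemma count_eigenvalues_prod (R : realType) n (B : 'M[R[i]]_n) (G : set R[i])
    (s : seq R[i]) :
  char_poly B = \prod_(z <- s) ('X - z%:P) ->
  count_eigenvalues B G = count [in G] s.
Proof.
move=> Bs; rewrite /count_eigenvalues fsbig_mkcondl.
have -> : [set z | eigenvalue B z] = [set` undup s].
  by apply/seteqP; split=> z /=;
    rewrite mem_undup eigenvalue_root_char Bs root_prod_XsubC.
rewrite -fsbig_seq ?undup_uniq// -big_mkcond /= -sum1_count.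
rewrite -[RHS]big_undup_iterop_count; apply: eq_bigr => z _.
by rewrite Monoid.iteropE iter_addn_0 mul1n Bs mu_prod_XsubC.
Qed.

Lemma char_poly_split (R : realType) n (B : 'M[R[i]]_n) :
  exists lam : 'I_n -> R[i], char_poly B = \prod_i ('X - (lam i)%:P).
Proof.
have [s] := closed_field_poly_normal (char_poly B).
rewrite (monicP (char_poly_monic B)) scale1r => Bs.
have sn : size s = n.
  by have := size_char_poly B; rewrite Bs size_prod_XsubC => -[].
by exists (fun i => s`_i); rewrite Bs (big_nth 0) sn big_mkord.
Qed.

Lemma continuous_horner_char_poly (K : numFieldType) (T : topologicalType) n
    (B : T -> 'M[K]_n) (z : K) :
  (forall i j, continuous (fun t => B t i j : K^o)) ->
  continuous (fun t => (char_poly (B t)).[z] : K^o).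
Proof.
move=> cB; rewrite [X in continuous X](_ : _ = fun t => \det (z%:M - B t)).
  apply: continuous_det => i j.
  rewrite [X in continuous X](_ : _ = cst (z%:M i j) \- (fun t => B t i j)).
    by move=> t; apply: continuousB; [exact: cst_continuous|exact: cB].
  by apply/funext => t /=; rewrite !mxE.
by apply/funext => t; rewrite horner_char_poly.
Qed.

Section Homotopy.
Context {R : realType} {n : nat} (B : R -> 'M[R[i]]_n) (a b : R).
Context (K L : set R[i]).
Context (cB : forall i j, continuous (fun t => B t i j : R[i]^o)).
Context (cptK : compact (K : set R[i]^o)).
Context (cptL : compact (L : set R[i]^o)).
Context (KL0 : K `&` L = set0).
Context (eigB : forall t, a <= t <= b -> forall z, eigenvalue (B t) z ->
  (K `|` L) z).

(** Membership of each lam_i is prescribed by J so that, although the listing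
of the eigenvalues is not canonical, it ranges over a product of compact
sets. *)
Let spectrum_split (J : {set 'I_n}) : set R :=
  [set t | a <= t <= b /\ exists lam : 'I_n -> R[i],
    (forall i, (if i \in J then K else L) (lam i)) /\
    char_poly (B t) = \prod_i ('X - (lam i)%:P)].

(** A projection of a compact set is compact, hence closed. *)
Let closed_spectrum_split J : closed (spectrum_split J).
Proof.
pose P := prod_topology (fun _ : 'I_n => R[i]^o).
pose E : set (R * P) :=
  [set p | forall z, (char_poly (B p.1)).[z] = \prod_i (z - p.2 i)].
pose X : set (R * P) := `[a, b]%classic `*`
  [set f | forall i, (if i \in J then K else L : set R[i]^o) (f i)].
have XE : spectrum_split J = fst @` (X `&` E).
  apply/seteqP; split=> [t [tab [lam [lamJ Blam]]]|_ [[t lam] [XE Et] <-]].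
    exists (t, lam : P) => //; split=> [|z /=]; first by rewrite /X /= in_itv.
    rewrite Blam horner_prod; apply: eq_bigr => i _.
    by rewrite hornerXsubC.
  move: XE => [/= + lamJ]; rewrite in_itv /= => tab.
  split=> //; exists lam; split=> //.
  apply: poly_ext => z; rewrite Et horner_prod; apply: eq_bigr => i _.
  by rewrite hornerXsubC.
apply: compact_closed; first exact: norm_hausdorff.
rewrite XE; apply: continuous_compact.
  by apply: continuous_subspaceT => p; exact: cvg_fst.
apply: compact_closedI.
  apply: compact_setX; first exact: segment_compact.
  apply: (@tychonoff 'I_n (fun=> R[i]^o)
    (fun i => if i \in J then K else L)) => i.
  by case: ifP.
rewrite (_ : E = \bigcap_(z in setT) (fun p : R * P =>
    (char_poly (B p.1)).[z] - \prod_i (z - p.2 i) : R[i]^o) @^-1` [set 0]).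
  apply: closed_bigI => z _; apply: preimage_closed.
    move=> p _; apply: continuousB.
      apply: (@continuous_horner_char_poly _ _ _
        (fun p : R * P => B p.1)) => i j {}p.
      apply: (@continuous_comp _ _ _ fst (fun t => B t i j : R[i]^o)).
        exact: cvg_fst.
      exact: cB.
    apply: (@continuous_big _ R[i]^o _ _ _ _ _
      (fun i => cst z \- (fun p : R * P => p.2 i))) => [|i _ {}p].
      exact: mul_continuous.
    apply: continuousB; first exact: cst_continuous.
    apply: (@continuous_comp _ _ _ snd (fun f : P => f i)).
      exact: cvg_snd.
    exact: (@proj_continuous _ (fun=> R[i]^o)).
  exact/accessible_closed_set1/hausdorff_accessible/norm_hausdorff.
apply/seteqP; split=> [p Ep z _ /=|p Ep z]; first by rewrite Ep subrr.
by apply/eqP; rewrite -subr_eq0; apply/eqP/Ep.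
Qed.

(** As K and L are disjoint, J is exactly the set of indices whose eigenvalue is
in K. *)
Let count_spectrum_split J t : spectrum_split J t ->
  count_eigenvalues (B t) K = #|J|.
Proof.
move=> [_ [lam [lamJ Blam]]].
rewrite (@count_eigenvalues_prod _ _ _ _ (map lam (enum 'I_n))); last first.
  by rewrite big_map big_enum.
rewrite count_map -sum1_count big_enum_cond /= -sum1_card.
apply: eq_bigl => i /=.
have := lamJ i; case: ifP => [iJ Ki|iJ Li]; first exact/mem_set.
apply/negbTE/negP => /set_mem Ki.
by have : (K `&` L) (lam i) by []; rewrite KL0.
Qed.

Let spectrum_split_total t : a <= t <= b -> exists J, spectrum_split J t.
Proof.
move=> tab; have [lam Blam] := char_poly_split (B t).
exists (finset (fun i => lam i \in K)); split=> //; exists lam; split=> // i.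
rewrite inE; case: ifPn => [/set_mem//|/negP nK].
have [] // : (K `|` L) (lam i); last by move=> /mem_set.
apply: (eigB tab); rewrite eigenvalue_root_char Blam.
rewrite -(big_map lam xpredT (fun z => 'X - z%:P)) root_prod_XsubC.
by rewrite map_f ?mem_index_enum.
Qed.

(** The set of parameters where the count has a given value and its complement
in the interval are both finite unions of sets [spectrum_split J], hence closed;
the interval being connected, one of them is empty. *)
Lemma count_eigenvalues_homotopy s t : a <= s <= b -> a <= t <= b ->
  count_eigenvalues (B s) K = count_eigenvalues (B t) K.
Proof.
move=> sab tab; pose c u := count_eigenvalues (B u) K.
pose lvl (P : pred nat) :=
  \bigcup_(J in [set J : {set 'I_n} | P #|J|]) spectrum_split J.
have lvlE P u : lvl P u <-> a <= u <= b /\ P (c u).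
  split=> [[J PJ uJ]|[uab Pu]].
    by rewrite /c (count_spectrum_split uJ); case: uJ.
  have [J uJ] := spectrum_split_total uab.
  by exists J => //=; rewrite -(count_spectrum_split uJ).
have lvlC P : closed (lvl P).
  apply: closed_bigcup => [|J _]; first exact: finite_finset.
  exact: closed_spectrum_split.
have : lvl (pred1 (c t)) = `[a, b]%classic.
  apply: (@segment_connected R a b).
  - by exists t; apply/lvlE; split=> //=.
  - exists (~` lvl (predC1 (c t))); first exact: closed_openC.
    apply/seteqP; split=> u /=; rewrite in_itv /=.
      by move=> /lvlE[uab /= /eqP ut]; split=> // /lvlE[_ /=]; rewrite ut eqxx.
    move=> [uab nu]; apply/lvlE; split=> //=; apply/negPn/negP => ut.
    by apply: nu; apply/lvlE.
  - exists (lvl (pred1 (c t))) => //; apply/seteqP; split=> u /=; last by case.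
    by move=> ut; split=> //; move/lvlE: ut => []; rewrite in_itv.
move=> /seteqP[_ /(_ s)]; rewrite /= in_itv /= => /(_ sab) /lvlE[_ /eqP].
by [].
Qed.

End Homotopy.

(** * Gersgorin disks *)

Lemma eigenvalue_trmx (F : fieldType) n (B : 'M[F]_n) z :
  eigenvalue B^T z = eigenvalue B z.
Proof.
rewrite !eigenvalue_root_char !rootE !horner_char_poly -[in LHS]det_tr.
by rewrite raddfB /= trmxK tr_scalar_mx.
Qed.

(** Gersgorin's theorem.  In the row of the largest entry of an eigenvector v,
the equation (z - B i i) v_i = sum_(j != i) B i j v_j can be divided by
|v_i|, which dominates every |v_j|. *)
Lemma gersgorin (R : realType) n (B : 'M[R[i]]_n) z :
  eigenvalue B z -> exists i, gersgorin_disk B i z.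
Proof.
(* Eigenvectors are row vectors, while the disks involve the rows of B:
   transposing gives a right eigenvector of B. *)
rewrite -eigenvalue_trmx => /eigenvalueP[v vB v0].
have vBi i : \sum_j B i j * v ord0 j = z * v ord0 i.
  have := congr1 (fun w : 'rV_n => w ord0 i) vB; rewrite !mxE => <-.
  by apply: eq_bigr => j _; rewrite mxE mulrC.
have [i0 vi0] : exists i0, v ord0 i0 != 0.
  apply/existsP; apply: contraNT v0; rewrite negb_exists => /forallP v0.
  by apply/eqP/rowP => j; rewrite mxE; apply/eqP; move: (v0 j); rewrite negbK.
(* A maximum can only be taken in the totally ordered R. *)
pose N i := complex.Re `|v ord0 i|.
have NE i : `|v ord0 i| = (N i)%:C by rewrite RRe_real ?normr_real.
have [i _ /(_ _ isT) Ni] := Order.TotalTheory.arg_maxP N (erefl : xpredT i0).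
exists i.
have vi_gt0 : 0 < `|v ord0 i|.
  apply: (@lt_le_trans _ _ `|v ord0 i0|); first by rewrite normr_gt0.
  by rewrite !NE lecR; exact: Ni.
rewrite /gersgorin_disk /= -(ler_pM2r vi_gt0) -normrM mulrBl -vBi.
rewrite (bigD1 i) //= addrAC subrr add0r mulr_suml.
apply: le_trans (ler_norm_sum _ _ _) _; apply: ler_sum => j _.
by rewrite normrM ler_wpM2l// !NE lecR; exact: Ni.
Qed.

Section GersgorinPath.
Context {R : realType} {n : nat} (A : 'M[R[i]]_n).

Lemma gersgorin_pathE t i j :
  gersgorin_path A t i j = if i == j then A i j else t%:C * A i j.
Proof.
rewrite !mxE; have [->|ij] := eqVneq i j; first by rewrite subrr mulr0 addr0.
by rewrite !mulr0n subr0 add0r.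
Qed.

Lemma continuous_gersgorin_path i j :
  continuous (fun t => gersgorin_path A t i j : R[i]^o).
Proof.
have -> : (fun t => gersgorin_path A t i j) =
    if i == j then cst (A i j) else (fun t => t%:C) \* cst (A i j).
  by apply/funext => t; rewrite gersgorin_pathE; case: ifP.
case: ifP => _ t; first exact: cst_continuous.
apply: continuousM; last exact: cst_continuous.
exact: continuous_real_complex.
Qed.

(** The disk of A(t) has the center of the disk of A and t times its radius, so
it is contained in the latter for t in [0, 1]. *)
Lemma eigenvalue_gersgorin_path t z : 0 <= t <= 1 ->
  eigenvalue (gersgorin_path A t) z -> exists i, gersgorin_disk A i z.
Proof.
move=> /andP[t0 t1] /gersgorin[k zk]; exists k; move: zk.
rewrite /gersgorin_disk /= gersgorin_pathE eqxx => zk.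
apply: (le_trans zk); apply: ler_sum => j jk.
rewrite gersgorin_pathE eq_sym (negbTE jk) normrM ler_piMl// ger0_norm ?ler0c//.
by rewrite -[1]/(1%:C) lecR.
Qed.

Let radius_ge0 i : 0 <= \sum_(j < n | j != i) `|A i j|.
Proof. exact: sumr_ge0. Qed.

Lemma connected_gersgorin_disk i : connected (gersgorin_disk A i : set R[i]^o).
Proof. exact: connected_disk. Qed.

Lemma compact_gersgorin_region (D : {set 'I_n}) :
  compact (\bigcup_(i in [set` D]) gersgorin_disk A i : set R[i]^o).
Proof.
rewrite (_ : [set` D] = [set` enum D]).
  rewrite bigcup_seq; apply: bigsetU_compact => i _.
  by apply: compact_disk; rewrite realE radius_ge0.
by apply/seteqP; split=> i /=; rewrite mem_enum.
Qed.

(** The union of G with a disk that meets it is again a connected region, and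
maximality makes it equal to G. *)
Lemma gersgorin_disk_dichotomy G i : connected_gersgorin_region A G ->
  gersgorin_disk A i `<=` G \/ gersgorin_disk A i `&` G = set0.
Proof.
move=> [[D D0 GD] cG maxG].
have [|/set0P GDi] := eqVneq (gersgorin_disk A i `&` G) set0; [by right|left].
rewrite -(maxG (gersgorin_disk A i `|` G)); first exact: subsetUl.
- exists (i |: D)%SET; first by apply/set0Pn; exists i; rewrite !inE eqxx.
  rewrite GD; apply/seteqP; split=> [z [zi|[j jD zj]]|z [j /=]].
  + by exists i => //=; rewrite !inE eqxx.
  + by exists j => //=; rewrite !inE; move: jD => /= ->; rewrite orbT.
  + by rewrite !inE => /orP[/eqP ->|jD zj]; [left|right; exists j].
- apply: connectedU => //; exact: connected_gersgorin_disk.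
- exact: subsetUr.
Qed.

End GersgorinPath.

Theorem proposition6 (R : realType) (n : nat) (A : 'M[R[i]]_n)
    (G : set R[i]) (hG : connected_gersgorin_region A G) :
  forall s t : R, 0 <= s <= 1 -> 0 <= t <= 1 ->
    count_eigenvalues (gersgorin_path A s) G =
    count_eigenvalues (gersgorin_path A t) G.
Proof.
have [[D _ GD] _ _] := hG.
pose D' : {set 'I_n} := [set i | gersgorin_disk A i `&` G == set0]%SET.
pose L := \bigcup_(i in [set` D']) gersgorin_disk A i.
have LP i : i \in D' -> gersgorin_disk A i `&` G = set0.
  by rewrite inE => /eqP.
apply: (@count_eigenvalues_homotopy _ _ _ _ _ _ L).
- exact: continuous_gersgorin_path.
- rewrite GD; exact: compact_gersgorin_region.
- exact: compact_gersgorin_region.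
- apply/seteqP; split=> // z [Gz [i /= iD' zi]].
  have : (gersgorin_disk A i `&` G) z by split.
  by rewrite LP.
- move=> t t01 z /(eigenvalue_gersgorin_path t01)[i zi].
  have [iG|iG] := gersgorin_disk_dichotomy i hG; first by left; exact: iG.
  by right; exists i => //=; rewrite inE iG eqxx.
Qed.
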